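(* Let $G=(V,E)$ be a connected graph, let $H$ be an abelian Hausdorff topological group, and let $A\subseteq H$ be a compact subset. Then $G$ has an $A$-flow if and only if, for every finite subset $M$ of $\mathcal{B}_{\rm fin}(G)$, the multigraph $G_M$ has an $A$-flow.
   Context: Graphs may be infinite of any cardinality, need not be locally finite, and may have parallel edges and loops. A directed edge of $G$ is a triple $(e,x,y)$ with $e=xy\in E$; for $\overrightarrow{e}=(e,x,y)$ write $\overleftarrow{e}=(e,y,x)$. $\overrightarrow{E}$ is the set of all directed edges. $H^{\overrightarrow{E}}$ denotes the set of maps $f:\overrightarrow{E}\to H$ with $f(\overrightarrow{e})=-f(\overleftarrow{e})$ for every non-loop edge $e$ of $G$, and $A^{\overrightarrow{E}}$ the set of those $f\in H^{\overrightarrow{E}}$ all of whose values lie in $A$. For $X\subseteq V$ and $Y=V\setminus X$, the cut $E(X,Y)$ is the set of edges of $G$ with one endpoint in $X$ and the other in $Y$; $\overrightarrow{E}(X,Y)$ is the set of directed edges $(e,x,y)$ with $x\in X$, $y\in Y$. $\mathcal{B}(G)$ is the set of all cuts of $G$ and $\mathcal{B}_{\rm fin}(G)$ is the set of all finite cuts. An $A$-flow of $G$ is an $f\in A^{\overrightarrow{E}}$ with $\sum_{\overrightarrow{e}\in\overrightarrow{E}(X,Y)}f(\overrightarrow{e})=0$ for every finite cut $E(X,Y)$ of $G$. The multigraph $G_M$: let $M=\{C_1,\dots,C_t\}\subseteq\mathcal{B}_{\rm fin}(G)$, where $C_i=E(A_i,B_i)$ with $B_i=V\setminus A_i$. The vertices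 of $G_M$ are the words $X_1\cdots X_t$ with $X_i\in\{A_i,B_i\}$ and $\bigcap_{i=1}^t X_i\neq\varnothing$; thus the vertices of $G_M$ correspond to the classes of a partition of $V$. Between two vertices $X_1\cdots X_t$ and $X'_1\cdots X'_t$ (possibly equal) there is an edge for each edge of $G$ between $\bigcap_i X_i$ and $\bigcap_i X'_i$, so the edges of $G_M$ are identified with the edges of $G$ (edges inside a class become loops). Under this identification an $A$-flow of $G_M$ is an $f\in A^{\overrightarrow{E}}$ (with $\overrightarrow{E}$ the directed edges of $G$) such that $\sum_{\overrightarrow{e}\in\overrightarrow{E}(X,Y)}f(\overrightarrow{e})=0$ for every pair $(X,Y)$ with $E(X,Y)\in\mathcal{B}(G_M)$, i.e. every bipartition $(X,Y)$ of $V$ in which each of $X$, $Y$ is a union of classes of the partition. *)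

(* Defs.v *)
(* MathComp-Analysis *)
From HB Require Import structures.
From Stdlib Require Import Relation_Operators.
From mathcomp Require Import all_boot all_order all_algebra.
From mathcomp Require Import all_classical all_reals all_analysis.
Set Implicit Arguments.
Unset Strict Implicit.
Unset Printing Implicit Defensive.
Import GRing.Theory.
Local Open Scope classical_set_scope.
Local Open Scope ring_scope.

(* [joins e x y] means that x and y are the endpoints of e, in either order;
   loops are the edges with [joins e x x]. *)
Record mgraph := MGraph {
  vertex : Type;
  edge : Type;
  joins : edge -> vertex -> vertex -> Prop;
  joins_sym : forall e x y, joins e x y -> joins e y x;
  joins_ex : forall e, exists x y, joins e x y;
  joins_uniq : forall e x y x' y', joins e x y -> joins e x' y' ->
    (x' = x /\ y' = y) \/ (x' = y /\ y' = x) }.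

Definition adjacent (G : mgraph) (x y : vertex G) : Prop :=
  exists e : edge G, joins e x y.

Definition connected_graph (G : mgraph) : Prop :=
  forall x y : vertex G, clos_refl_trans (vertex G) (@adjacent G) x y.

(* The triples (e, x, y) with e = xy: two for each non-loop, one for each
   loop. *)
Record dedge (G : mgraph) := DEdge {
  dedge_edge : edge G;
  src : vertex G;
  tgt : vertex G;
  dedgeP : joins dedge_edge src tgt }.

HB.instance Definition _ (G : mgraph) := gen_eqMixin (dedge G).
HB.instance Definition _ (G : mgraph) := gen_choiceMixin (dedge G).

Definition drev (G : mgraph) (d : dedge G) : dedge G :=
  DEdge (joins_sym (dedgeP d)).

(* The condition on non-loops applies to d and to [drev d], so the values on
   non-loops lie in A and in -A. *)
Definition dmaps (G : mgraph) (H : zmodType) (A : set H) : set (dedge G -> H) :=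
  [set f | (forall d, src d <> tgt d -> f d = - f (drev d)) /\
           (forall d, A (f d))].

(* E(X, V \ X) *)
Definition cut (G : mgraph) (X : set (vertex G)) : set (edge G) :=
  [set e | exists x y, [/\ joins e x y, X x & (~` X) y]].

(* The directed edges of E(X, V \ X), from X to V \ X. *)
Definition dcut (G : mgraph) (X : set (vertex G)) : set (dedge G) :=
  [set d | X (src d) /\ (~` X) (tgt d)].

Definition cuts (G : mgraph) : set (set (edge G)) :=
  [set C | exists X : set (vertex G), C = cut X].

Definition fin_cuts (G : mgraph) : set (set (edge G)) :=
  [set C | cuts C /\ finite_set C].

Lemma finite_dcut (G : mgraph) (X : set (vertex G)) :
  finite_set (cut X) -> finite_set (dcut X).
Proof.
have inj : {in dcut X &, injective (@dedge_edge G)}.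
  move=> [e x y exy] [e' x' y' exy'] /set_mem[/= Xx Xy] /set_mem[/= Xx' Xy'] ee'.
  move: exy'; rewrite -ee' => exy'.
  have [[ex ey]|[ex ey]] := joins_uniq exy exy'; last by rewrite ex in Xx'.
  by move: exy'; rewrite ex ey => exy'; rewrite (Prop_irrelevance exy exy').
move=> fX; rewrite -(eq_finite_set (inj_card_eq inj)).
apply: sub_finite_set fX => _ [d [Xd Yd] <-]; exists (src d), (tgt d).
by split=> //; exact: dedgeP.
Qed.

Definition is_flow (G : mgraph) (H : zmodType) (A : set H) (f : dedge G -> H) :
    Prop :=
  dmaps A f /\
  (forall X : set (vertex G), finite_set (cut X) ->
     \sum_(d \in dcut X) f d = 0).

Definition has_flow (G : mgraph) (H : zmodType) (A : set H) : Prop :=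
  exists f : dedge G -> H, is_flow A f.

(* For a cut C, a set A_C with C = E(A_C, V \ A_C). If G is connected, then A_C
   is determined up to complementation. *)
Definition side (G : mgraph) (C : set (edge G)) : set (vertex G) :=
  xget set0 [set X | C = cut X].

(* The words over M with letters in {A_C, V \ A_C} and nonempty intersection;
   a word is indexed by the cuts in M themselves rather than by an
   enumeration of M. *)
Record word (G : mgraph) (M : set (set (edge G))) := Word {
  letter : M -> set (vertex G);
  letterP : forall C : M,
    letter C = side (val C) \/ letter C = ~` side (val C);
  word_neq0 : (\bigcap_C letter C) !=set0 }.

Definition class_of (G : mgraph) (M : set (set (edge G))) (w : word M) :
  set (vertex G) := \bigcap_C letter w C.

Lemma word_uniq (G : mgraph) (M : set (set (edge G))) (w w' : word M)
    (x : vertex G) : class_of w x -> class_of w' x -> w = w'.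
Proof.
case: w w' => [l lP l0] [l' lP' l0'] wx wx'.
have ll' : l = l'.
  apply/funext => C; move: (wx C I) (wx' C I); rewrite /=.
  by case: (lP C) (lP' C) => -> [] -> //.
move: lP' l0' wx'; rewrite -ll' => lP' l0' _.
by rewrite (Prop_irrelevance lP lP') (Prop_irrelevance l0 l0').
Qed.

Lemma word_ex (G : mgraph) (M : set (set (edge G))) (x : vertex G) :
  exists w : word M, class_of w x.
Proof.
pose l (C : M) := [set y | side (val C) y <-> side (val C) x].
have lx : (\bigcap_C l C) x by [].
have lP C : l C = side (val C) \/ l C = ~` side (val C).
  have [sx|sx] := pselect (side (val C) x); [left|right];
    by apply/seteqP; split=> y; rewrite /l /=; tauto.
by exists (@Word G M l lP (ex_intro _ x lx)).
Qed.

Definition contract_joins (G : mgraph) (M : set (set (edge G))) (e : edge G)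
    (w w' : word M) : Prop :=
  exists x y, [/\ joins e x y, class_of w x & class_of w' y].

Lemma contract_joins_sym (G : mgraph) (M : set (set (edge G))) (e : edge G)
    (w w' : word M) : contract_joins e w w' -> contract_joins e w' w.
Proof. by move=> [x [y [/joins_sym ? ? ?]]]; exists y, x. Qed.

Lemma contract_joins_ex (G : mgraph) (M : set (set (edge G))) (e : edge G) :
  exists w w' : word M, contract_joins e w w'.
Proof.
have [x [y exy]] := joins_ex e.
have [[w wx] [w' wy]] := (word_ex M x, word_ex M y).
by exists w, w', x, y.
Qed.

Lemma contract_joins_uniq (G : mgraph) (M : set (set (edge G))) (e : edge G)
    (w1 w2 w1' w2' : word M) :
  contract_joins e w1 w2 -> contract_joins e w1' w2' ->
  (w1' = w1 /\ w2' = w2) \/ (w1' = w2 /\ w2' = w1).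
Proof.
move=> [x [y [exy wx wy]]] [x' [y' [exy' wx' wy']]].
have [[ex ey]|[ex ey]] := joins_uniq exy exy'; rewrite ex ey in wx' wy';
  [left|right]; split; [exact: word_uniq wx' wx|exact: word_uniq wy' wy|
    exact: word_uniq wx' wy|exact: word_uniq wy' wx].
Qed.

(* The edges of G_M are those of G; edges inside a class become loops. *)
Definition contract (G : mgraph) (M : set (set (edge G))) : mgraph :=
  MGraph (@contract_joins_sym G M) (@contract_joins_ex G M)
         (@contract_joins_uniq G M).

(* The union of the classes of V that correspond to the words in W. *)
Definition lift_set (G : mgraph) (M : set (set (edge G)))
    (W : set (vertex (contract M))) : set (vertex G) :=
  \bigcup_(w in W) class_of w.

Lemma cut_contract (G : mgraph) (M : set (set (edge G)))
    (W : set (vertex (contract M))) : cut W = cut (lift_set W) :> set (edge G).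
Proof.
apply/seteqP; split=> e.
  move=> [w [w' [[x [y [exy wx wy]]] Ww Ww']]]; exists x, y; split=> //.
    by exists w.
  by move=> [v Wv vy]; apply: Ww'; rewrite (word_uniq wy vy).
move=> [x [y [exy [w Ww wx] nWy]]]; have [w' wy] := word_ex M y.
by exists w, w'; split=> // [|Ww']; [exists x, y|apply: nWy; exists w'].
Qed.

Lemma finite_cut_contract (G : mgraph) (M : set (set (edge G)))
    (W : set (vertex (contract M))) :
  finite_set M -> M `<=` @fin_cuts G -> finite_set (cut (lift_set W)).
Proof.
move=> finM MB; rewrite -cut_contract.
have finU : finite_set (\bigcup_(C in M) C).
  by apply: bigcup_finite => // C /MB[].
apply: sub_finite_set finU => e [w [w' [[x [y [exy wx wy]]] Ww Ww']]].
have [C lC] : exists C : M, letter w C <> letter w' C.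
  apply: contrapT => /forallNP ll; apply: Ww'; suff <- : w = w' by [].
  apply: (word_uniq wx) => C _; have := wx C I.
  by have /contrapT -> := ll C.
have MC : M (val C) by apply: set_mem; exact: (valP C).
exists (val C) => //.
have [[X eX] _] := MB _ MC.
have sC : val C = cut (side (val C)).
  exact: (@xgetPex _ set0 [set X | val C = cut X] (ex_intro _ X eX)).
rewrite sC; move: (wx C I) (wy C I) lC.
case: (letterP w C) (letterP w' C) => -> [] -> // sx sy _.
  by exists x, y.
by exists y, x; split=> //; exact: joins_sym.
Qed.

(* A-flows of G_M are maps on the directed edges of G, not of G_M: an edge
   that becomes a loop of G_M but is not a loop of G remains subject to
   f(e,x,y) = - f(e,y,x). If M is a finite set of finite cuts, then all the sums
   are finite, by finite_cut_contract and finite_dcut. *)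
Definition is_contract_flow (G : mgraph) (M : set (set (edge G))) (H : zmodType)
    (A : set H) (f : dedge G -> H) : Prop :=
  dmaps A f /\
  (forall W : set (vertex (contract M)),
     \sum_(d \in dcut (lift_set W)) f d = 0).

Definition contract_has_flow (G : mgraph) (M : set (set (edge G)))
    (H : zmodType) (A : set H) : Prop :=
  exists f : dedge G -> H, is_contract_flow M A f.

(* Main.v *)
From Stdlib Require Import Relation_Operators.
From mathcomp Require Import all_boot all_algebra.
From mathcomp Require Import finmap.
From mathcomp Require Import all_classical all_analysis.
Require Import Defs.
Set Implicit Arguments.
Unset Strict Implicit.
Local Open Scope classical_set_scope.

(** A map [f] with values in [A] is a flow when it satisfies a system of
    equations: [f d = - f (drev d)] for each non-loop [d], and one equation
    for each set of vertices with a finite cut. Each equation involves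
    finitely many coordinates of [f], hence defines a closed subset of
    [H ^ dedge G], because [H] is a Hausdorff topological group. By Tychonoff's
    theorem the maps with values in [A] form a compact set, so the whole system
    has a solution there as soon as each finite subsystem has one
    ([compact_bigcap_closed]).

    Finitely many cut equations, for sides [X_1, ..., X_n], are solved by a
    flow of the contraction of [M = {cut X_1, ..., cut X_n}]. The words over
    [M] are written with chosen sides of the cuts, and here connectedness
    enters: a cut of a connected graph determines its side up to complement
    ([cut_inj]), so each [X_i] is a union of classes ([lift_set_surj]) and its
    equation is among those of the contraction. Conversely, every union of
    classes has a finite cut in [G], so that a flow of [G] is one of each
    contraction. *)

(** Compactness as the finite intersection property, for spaces without a
    distinguished point. *)
Lemma compact_bigcap_closed (T : topologicalType) (I : choiceType) (K : set T)
    (D : set I) (F : I -> set T) :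
  compact K -> D !=set0 -> (forall i, D i -> closed (F i)) ->
  finI D (fun i => K `&` F i) -> (K `&` \bigcap_(i in D) F i) !=set0.
Proof.
move=> cK [i0 Di0] cF finIF.
have fromD i : D i ->
    filter_from (finI_from D (fun i => K `&` F i)) id (K `&` F i).
  by move=> Di; exists (K `&` F i) => //; exact: finI_from1.
have FF := finI_filter finIF.
have [|p [Kp clp]] := cK _ FF.
  by apply: filterS (fromD _ Di0) => ? [].
exists p; split=> // i Di; apply: cF => // B; apply: clp.
by apply: filterS (fromD _ Di) => ? [].
Qed.

Lemma closed_zero_locus (T : topologicalType) (H : topologicalZmodType)
    (f : T -> H) :
  hausdorff_space H -> continuous f -> closed [set t | f t = 0%R].
Proof.
move=> hH cf; apply: (preimage_closed (D := [set 0%R])) => [x _|].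
  exact: cf.
exact/accessible_closed_set1/hausdorff_accessible.
Qed.

Lemma coord_continuous (I : eqType) (T : topologicalType) (i : I) :
  continuous (fun f : prod_topology (fun _ : I => T) => f i).
Proof. exact: (@proj_continuous _ (fun=> T)). Qed.

(** The maps with values in [A] form a compact set by Tychonoff's theorem, and
    antisymmetry cuts out a closed subset of it when written as the equations
    [f d + f (drev d) = 0] for the non-loops [d]. *)
Lemma compact_dmaps (G : mgraph) (H : topologicalZmodType) (A : set H) :
  hausdorff_space H -> compact A ->
  compact (dmaps A : set (prod_topology (fun _ : dedge G => H))).
Proof.
move=> hH cA.
have cprod := @tychonoff (dedge G) (fun=> H) (fun=> A) (fun=> cA).
apply: (subclosed_compact _ cprod); last by move=> f [].
have -> : dmaps A = [set f : prod_topology (fun _ : dedge G => H) |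
    forall d, A (f d)] `&` \bigcap_(d in [set d | src d <> tgt d])
      [set f | (f d + f (drev d))%R = 0%R].
  apply/seteqP; split=> f; first move=> [fN fA]; last move=> [fA fN].
    by split=> // d nl; rewrite /= fN// GRing.addNr.
  by split=> // d nl; apply/eqP; rewrite -GRing.addr_eq0; apply/eqP/fN.
apply: closedI; first exact: compact_closed (hausdorff_product (fun=> hH)) cprod.
apply: closed_bigI => d _; apply: closed_zero_locus => // f.
apply: (@continuous_comp _ _ _ (fun f : prod_topology (fun _ : dedge G => H) =>
  (f d, f (drev d))) (fun z : H * H => (z.1 + z.2)%R)); last exact: add_continuous.
have FF : Filter (nbhs f) by exact: nbhs_filter.
exact: (cvg_pair (@coord_continuous _ _ d f)
  (@coord_continuous _ _ (drev d) f)).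
Qed.

Lemma closed_sum_eq0 (I : choiceType) (H : topologicalZmodType) (D : set I) :
  hausdorff_space H -> finite_set D ->
  closed [set f : prod_topology (fun _ : I => H) |
    (\sum_(i \in D) f i)%R = 0%R].
Proof.
move=> hH finD.
have -> : [set f : prod_topology (fun _ : I => H) |
    (\sum_(i \in D) f i)%R = 0%R] =
    [set f | (\sum_(i <- fset_set D) f i)%R = 0%R].
  by apply/seteqP; split=> f; rewrite /= fsbig_finite.
apply: closed_zero_locus => //; apply: continuous_big => [|i _].
  exact: add_continuous.
exact: coord_continuous.
Qed.

(** The set of vertices on which [X] and [Y] agree is closed under adjacency,
    because an edge is in the common cut precisely when it changes membership
    in [X], and precisely when it changes membership in [Y]. Hence this set is
    empty or everything. *)
Lemma cut_inj (G : mgraph) (X Y : set (vertex G)) :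
  connected_graph G -> cut X = cut Y -> X = Y \/ X = ~` Y.
Proof.
move=> conG eXY.
have cutP (Z : set (vertex G)) e x y : joins e x y -> cut Z e <-> ~ (Z x <-> Z y).
  move=> exy; split=> [[x' [y' [exy' Zx Zy]]]|nZ].
    have [[ex ey]|[ex ey]] := joins_uniq exy exy'; rewrite ex in Zx;
      rewrite ey /setC/= in Zy; tauto.
  have [Zx|Zx] := pselect (Z x).
    by exists x, y; split=> // Zy; apply: nZ; tauto.
  by exists y, x; split=> //; [exact: joins_sym|apply: contrapT; tauto].
have agree x y : clos_refl_trans _ (@adjacent G) x y ->
    (X x <-> Y x) <-> (X y <-> Y y).
  elim=> [{}x {}y [e exy]|//|u v w _ IH1 _ IH2]; last by tauto.
  have := cutP X e x y exy; have := cutP Y e x y exy; rewrite eXY => cY cX.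
  case: (pselect (X x)) (pselect (X y)) (pselect (Y x)) (pselect (Y y)).
    by move=> ? [] ? [] ? [] ?; tauto.
  by move=> ? [] ? [] ? [] ?; tauto.
have [[x xXY]|nXY] := pselect (exists x, X x <-> Y x); [left|right];
  apply/seteqP; split=> y; rewrite /setC/=.
- by have := agree x y (conG x y); tauto.
- by have := agree x y (conG x y); tauto.
- by move=> Xy Yy; apply: nXY; exists y.
- by move=> nYy; apply: contrapT => nXy; apply: nXY; exists y.
Qed.

(** The chosen side of [cut X] is [X] or its complement, so a class that meets
    [X] has [X] itself as its letter at [cut X]. *)
Lemma lift_set_surj (G : mgraph) (M : set (set (edge G))) (X : set (vertex G)) :
  connected_graph G -> M (cut X) ->
  exists W : set (vertex (contract M)), lift_set W = X.
Proof.
move=> conG MX; exists [set w : word M | class_of w `<=` X].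
apply/seteqP; split=> [x [w]|x Xx]; first exact.
have [w wx] := word_ex M x; exists w => // y wy.
pose C : M := exist _ (cut X) (mem_set MX).
have eX : cut X = cut (side (cut X)).
  exact: (@xgetPex _ set0 [set Y | cut X = cut Y] (ex_intro _ X erefl)).
have := wx C I; have := wy C I; move: (letterP w C); rewrite [val C]/(cut X).
move: (side (cut X)) (letter w C) eX => s l eX lP ly lx.
by case: lP ly lx (cut_inj conG eX) => -> ly lx [] eXs; move: Xx;
  rewrite eXs /setC/=; move: ly lx; rewrite /setC/=; tauto.
Qed.

Lemma contract_has_flow_of_flow (G : mgraph) (H : zmodType) (A : set H)
    (M : set (set (edge G))) :
  finite_set M -> M `<=` @fin_cuts G -> has_flow G A -> contract_has_flow M A.
Proof.
move=> finM MB [f [fA f0]]; exists f; split=> // W.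
exact/f0/finite_cut_contract.
Qed.

Theorem theorem5 (G : mgraph) (H : topologicalZmodType) (A : set H) :
  connected_graph G -> hausdorff_space H -> compact A ->
  (has_flow G A <->
   forall M : set (set (edge G)),
     finite_set M -> M `<=` @fin_cuts G -> contract_has_flow M A).
Proof.
move=> conG hH cA; split=> [fl M finM MB|fl].
  exact: contract_has_flow_of_flow.
pose E (X : set (vertex G)) : set (prod_topology (fun _ : dedge G => H)) :=
  [set f | (\sum_(d \in dcut X) f d)%R = 0%R].
have [|X finX|D' D'fin|f [fA f0]] := @compact_bigcap_closed _ _ _
  [set X : set (vertex G) | finite_set (cut X)] E (@compact_dmaps G H A hH cA).
- by exists set0; apply: sub_finite_set (finite_set0 _) => e [x [y []]].
- exact/closed_sum_eq0/finite_dcut.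
- have [||f [fA f0]] := fl (@cut G @` [set` D']).
  + exact: finite_image.
  + move=> _ [X XD' <-]; split; first by exists X.
    by have := D'fin _ XD'; rewrite inE.
  + exists f => X XD'; split=> //.
    have [|W <-] := @lift_set_surj G (@cut G @` [set` D']) X conG; last exact: f0.
    by exists X.
- by exists f.
Qed.
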